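(* Let $K$ be a field, let $g\ge 2$ and $n\ge 1$ be integers, and let $m_1,\ldots,m_n$ be integers with $m_n\ge 0$, $m_{n-1}\ge 1$ and $m_i\ge 2$ for $1\le i\le n-2$ (conditions on indices smaller than $1$ being vacuous). Let $R$ be the polynomial ring and $I=I_{g,(m_1,\ldots,m_n)}\subseteq R$ the homogeneous ideal defined in the context. Then $\operatorname{depth}(R/I)=0$.
   Context: Set $M_n=m_n$ and $M_k=m_k-1$ for $1\le k<n$; set $d_k=m_k+m_{k+1}+\cdots+m_n+1$ for $1\le k\le n$, and $d=d_1$. For $0\le k\le n$ let $\mathcal{A}_k$ be the set of $g\times n$ integer matrices $A=(a_{j,k'})$ (with $1\le j\le g$, $1\le k'\le n$) such that: for $1\le k'\le k$, $0\le a_{j,k'}\le M_{k'}$ for all $j$ and $\sum_{j=1}^g a_{j,k'}=m_{k'}$; and for $k<k'\le n$, $a_{j,k'}=0$ for all $j$. (So $\mathcal{A}_0$ consists only of the zero matrix.) Let $R=K[x_{j,k},\,y_A \mid 1\le j\le g,\ 1\le k\le n,\ A\in\mathcal{A}_n]$ be the polynomial ring in these variables with its standard grading (all variables in degree $1$), and let $\mathfrak{m}$ be its graded maximal ideal, generated by all the variables. For a $g\times n$ matrix $A=(a_{j,k})$ of nonnegative integers write $X^A=\prod_{j,k}x_{j,k}^{a_{j,k}}$. Define $$I_{g,(m_1,\ldots,m_n)}=(x_{1,1}^d,\ldots,x_{g,1}^d,f),$$ $$f=\sum_{k=1}^{n-1}\ \sum_{A\in\mathcal{A}_{k-1}}\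 \sum_{j=1}^g X^A\,x_{j,k}^{m_k}\,x_{j,k+1}^{d_{k+1}}\;+\;\sum_{B\in\mathcal{A}_n}X^B\,y_B,$$ where empty sums are $0$. $\operatorname{depth}(R/I)$ denotes the length of a maximal regular sequence on $R/I$ contained in $\mathfrak{m}$. *)

(* Defs.v *)
From mathcomp Require Import all_boot all_algebra.
From mathcomp Require Import mpoly.

Set Implicit Arguments.
Unset Strict Implicit.
Unset Printing Implicit Defensive.

Import GRing.Theory.
Local Open Scope ring_scope.

(* Ideals of a commutative ring are predicates [R -> Prop]. *)

Definition ideal_gen (R : comNzRingType) (s : seq R) : R -> Prop :=
  fun p => exists c : 'I_(size s) -> R, p = \sum_i c i * s`_i.

Definition ideal_add (R : comNzRingType) (I J : R -> Prop) : R -> Prop :=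
  fun p => exists a b : R, [/\ I a, J b & p = a + b].

(* The ideal J is the zero element of R/J: the two conditions say that s`_i is
   a nonzerodivisor on M/(s_0, ..., s_(i-1))M and that M/(s)M != 0, for the
   R-module M = R/I. *)
Definition regular_on_quotient (R : comNzRingType) (I : R -> Prop)
    (s : seq R) : Prop :=
  (forall i : nat, (i < size s)%N -> forall h : R,
     ideal_add I (ideal_gen (take i s)) (s`_i * h) ->
     ideal_add I (ideal_gen (take i s)) h)
  /\ ~ ideal_add I (ideal_gen s) 1.

Definition regular_seq_in (R : comNzRingType) (m I : R -> Prop)
    (s : seq R) : Prop :=
  (forall p, p \in s -> m p) /\ regular_on_quotient I s.

Definition maximal_regular_seq (R : comNzRingType) (m I : R -> Prop)
    (s : seq R) : Prop :=
  regular_seq_in m I s /\ forall p : R, ~ regular_seq_in m I (rcons s p).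

(* The depth of R/I with respect to m is r. That maximal regular sequences have
   a common length is part of the assertion rather than presupposed. *)
Definition depth_quotient_is (R : comNzRingType) (m I : R -> Prop)
    (r : nat) : Prop :=
  (exists s, maximal_regular_seq m I s /\ size s = r)
  /\ forall s, maximal_regular_seq m I s -> size s = r.

(* Indices are 0-based: the mathematical m_k, d_k, M_k (1 <= k <= n) are
   [m i], [dd m i], [Mbound m i] for the i : 'I_n of value k - 1. *)

Definition dd (n : nat) (m : 'I_n -> nat) (k : nat) : nat :=
  (\sum_(i < n | (k <= i)%N) m i).+1.

(* M_k; the predecessor truncates only for m_k = 0 with k < n, which is excluded
   under the hypotheses on m_1, ..., m_n. *)
Definition Mbound (n : nat) (m : 'I_n -> nat) (k : 'I_n) : nat :=
  if k.+1 == n then m k else (m k).-1.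

(* Matrices with entries in {0, ..., m_1 + ... + m_n}. This range loses no
   element of the sets A_k, whose entries in column k are at most m_k. *)
Notation expmx g n m := 'M['I_(@dd n m 0)]_(g, n).

(* The set A_k: here k counts the columns that are not forced to vanish. *)
Definition calA (g n : nat) (m : 'I_n -> nat) (k : nat) : {set expmx g n m} :=
  [set A : expmx g n m | [forall c : 'I_n,
     if (c < k)%N then
       [forall j : 'I_g, (A j c <= Mbound m c)%N]
       && ((\sum_(j < g) A j c)%N == m c)
     else [forall j : 'I_g, (A j c : nat) == 0%N]]].

(* Index type of the variables: inl (j, k) for x_(j,k), inr A for y_A. *)
Definition var (g n : nat) (m : 'I_n -> nat) : finType :=
  (('I_g * 'I_n) + {A : expmx g n m | A \in calA g m n})%type.

Notation polyR K g m := {mpoly K[#|var g m|]}.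

Definition xvar (K : fieldType) (g n : nat) (m : 'I_n -> nat)
    (j : 'I_g) (k : 'I_n) : polyR K g m :=
  'X_(enum_rank (inl (j, k) : var g m)).

Definition yvar (K : fieldType) (g n : nat) (m : 'I_n -> nat)
    (A : {A : expmx g n m | A \in calA g m n}) : polyR K g m :=
  'X_(enum_rank (inr A : var g m)).

Definition xmonom (K : fieldType) (g n : nat) (m : 'I_n -> nat)
    (A : expmx g n m) : polyR K g m :=
  \prod_(j < g) \prod_(k < n) xvar K m j k ^+ (A j k).

(* The double sum over k, l with l = k + 1 encodes the sum over k <= n - 1. *)
Definition fpoly (K : fieldType) (g n : nat) (m : 'I_n -> nat) : polyR K g m :=
  \sum_(k < n) \sum_(l < n | l == k.+1 :> nat) \sum_(A in calA g m k)
    \sum_(j < g) xmonom K A * xvar K m j k ^+ m k * xvar K m j l ^+ dd m l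
  + \sum_(B : {B : expmx g n m | B \in calA g m n}) xmonom K (val B) * yvar K B.

Definition idealI (K : fieldType) (g n : nat) (m : 'I_n -> nat) :
    polyR K g m -> Prop :=
  ideal_gen (rcons
    [seq xvar K m j k ^+ dd m 0
       | j <- enum 'I_g, k <- enum [pred k : 'I_n | k == 0%N :> nat]]
    (fpoly K g m)).

Definition maxideal (K : fieldType) (g n : nat) (m : 'I_n -> nat) :
    polyR K g m -> Prop :=
  ideal_gen [seq 'X_i | i : 'I_#|var g m|].

(* Main.v *)
Require Import Defs.
From mathcomp Require Import all_boot all_algebra.
From mathcomp Require Import mpoly.

Set Implicit Arguments.
Unset Strict Implicit.
Unset Printing Implicit Defensive.

Import GRing.Theory.
Local Open Scope ring_scope.

(** The quotient R/I has depth 0 because it has a socle element: the monomial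
    S = prod_(j, k) x_(j,k)^(d_k - 1) is not in I, while every variable
    multiplies it into I.  Every p in the maximal ideal then kills the nonzero
    class of S, so no nonempty sequence is regular ([depth0_of_socle]).

    That S is not in I is immediate: each generator of I is a combination of
    powers x_(j,k)^(d_k) and variables y_B, and S is divisible by none of
    these ([socle_notin]).

    For the other half, let C_c be the product of x_(j,i)^(d_i - 1) over all j
    and all columns i < c; the complete product is S.  The key claim is that
    the corner C_c x_(j,c)^(d_c) lies in I, for all j and c ([corner_in]).
    It contains x_(j,1)^d if c is the first column.  For c = k + 1, choose a
    matrix A in A_(k-1) and let T = X^A x_(j,k)^(m_k) x_(j,c)^(d_c), a term of
    f.  Multiply f by the cofactor C_c / (X^A x_(j,k)^(m_k)).  The term T
    becomes the desired corner.  Every other term T' lands on a multiple of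
    an earlier corner: in the first column i where T and T' differ, both have
    exponent sum m_i, so some exponent of T' exceeds that of T
    ([term_exp_overflow]).  In the product its exponent is then at least d_i,
    while the columns before i are filled to d_h - 1 exactly, as they were
    filled relative to T.  Hence T' contributes nothing modulo I, and neither
    does f, so the corner is in I ([f_term_in]).

    Terms with different indices must differ within the columns whose sums are
    prescribed ([term_exp_distinct]).  This is where the bounds M_k = m_k - 1
    enter: a term of index k puts all of m_k into a single entry of column k,
    which the matrices used in the later terms are not allowed to do.

    Finally x_(j,c) S is a multiple of a corner, and y_B S is obtained from
    the term X^B y_B of f by the same cofactor argument. *)

(** * Ideals and depth zero *)

Section IdealGen.
Context (R : comNzRingType).
Implicit Types (s : seq R) (m : R -> Prop).

Lemma ideal_gen0 s : ideal_gen s 0.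
Proof. by exists (fun=> 0); rewrite big1 // => i _; rewrite mul0r. Qed.

Lemma ideal_genD s p q : ideal_gen s p -> ideal_gen s q -> ideal_gen s (p + q).
Proof.
move=> [c ->] [c' ->]; exists (fun i => c i + c' i).
by rewrite -big_split; apply: eq_bigr => i _; rewrite mulrDl.
Qed.

Lemma ideal_genMl s h p : ideal_gen s p -> ideal_gen s (h * p).
Proof.
move=> [c ->]; exists (fun i => h * c i).
by rewrite mulr_sumr; apply: eq_bigr => i _; rewrite mulrA.
Qed.

Lemma ideal_genMr s h p : ideal_gen s p -> ideal_gen s (p * h).
Proof. by rewrite mulrC; apply: ideal_genMl. Qed.

Lemma ideal_gen_mem s p : p \in s -> ideal_gen s p.
Proof.
rewrite -index_mem => lt_ps; exists (fun i => (i == Ordinal lt_ps)%:R).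
rewrite (bigD1 (Ordinal lt_ps)) //= eqxx mul1r nth_index -?index_mem //.
by rewrite big1 ?addr0 // => i /negPf->; rewrite mul0r.
Qed.

Lemma ideal_gen_ind (P : R -> Prop) s :
    P 0 -> (forall p q, P p -> P q -> P (p + q)) ->
    (forall h p, p \in s -> P (h * p)) ->
  forall p, ideal_gen s p -> P p.
Proof.
move=> P0 PD Ps p [c ->]; elim/big_ind: _ => // i _.
exact/Ps/mem_nth.
Qed.

(** Solves for one summand; meant for the terms of a multiple of f. *)
Lemma ideal_gen_summand s (T : finType) (P : pred T) (F : T -> R) t :
    P t -> ideal_gen s (\sum_(u | P u) F u) ->
    (forall u, P u -> u != t -> ideal_gen s (F u)) ->
  ideal_gen s (F t).
Proof.
move=> Pt; rewrite (bigD1 t) //= => sF oF.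
set r := \sum_(u | _) _ in sF.
have sr : ideal_gen s r.
  rewrite /r; elim/big_ind: _ => [|p q|u /andP[]].
  - exact: ideal_gen0.
  - exact: ideal_genD.
  exact: oF.
rewrite -[F t](addrK r); apply: ideal_genD => //.
by rewrite -mulN1r; apply: ideal_genMl.
Qed.

Lemma ideal_add0 s p :
  ideal_add (ideal_gen s) (ideal_gen [::]) p <-> ideal_gen s p.
Proof.
split=> [[a [b [sa [c ->] ->]]]|sp]; first by rewrite big_ord0 addr0.
by exists p, 0; split; rewrite ?addr0 //; apply: ideal_gen0.
Qed.

(** A socle element is annihilated by the first entry of any would-be regular
    sequence, so only the empty sequence remains; that one is regular because
    an ideal avoiding [S] is proper. *)
Lemma depth0_of_socle s m S :
    ~ ideal_gen s S -> (forall p, m p -> ideal_gen s (p * S)) ->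
  depth_quotient_is m (ideal_gen s) 0.
Proof.
move=> sNS mS.
have noreg p t : ~ regular_seq_in m (ideal_gen s) (p :: t).
  case=> mp [/(_ 0%N (ltn0Sn _) S) /=]; rewrite !ideal_add0 => pS _.
  by apply/sNS/pS/mS/mp/mem_head.
split; last by case=> [//|p t [/noreg]].
exists [::]; split=> //; split; last by move=> p; apply: noreg.
split=> //; split=> // /ideal_add0 s1; apply: sNS.
by rewrite -[S]mulr1; apply: ideal_genMl.
Qed.

End IdealGen.

(** * Monomials in the x-variables *)

Section Monomials.
Context (K : fieldType) (g n : nat) (m : 'I_n -> nat).
Implicit Types (e : 'I_g -> 'I_n -> nat) (j : 'I_g) (k : 'I_n).

Definition xpow e : polyR K g m := \prod_j \prod_k xvar K m j k ^+ e j k.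

Lemma eq_xpow e e' : (forall j k, e j k = e' j k) -> xpow e = xpow e'.
Proof. by move=> ee'; apply: eq_bigr => j _; apply: eq_bigr => k _; rewrite ee'. Qed.

Lemma xpowD e e' : xpow e * xpow e' = xpow (fun j k => e j k + e' j k)%N.
Proof.
rewrite -big_split; apply: eq_bigr => j _; rewrite -big_split.
by apply: eq_bigr => k _; rewrite exprD.
Qed.

Lemma xpow_delta j0 k0 d :
  xvar K m j0 k0 ^+ d = xpow (fun j k => ((j == j0) && (k == k0)) * d)%N.
Proof.
rewrite /xpow (bigD1 j0) //= (bigD1 k0) //= !eqxx mul1n.
rewrite !big1 ?mulr1 // => [j /negPf->|k /negPf->].
  by rewrite big1 // => k _; rewrite mul0n expr0.
by rewrite andbF mul0n expr0.
Qed.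

Lemma xpow_dvd e e' :
  (forall j k, e j k <= e' j k)%N -> exists h, xpow e' = h * xpow e.
Proof.
move=> le_ee'; exists (xpow (fun j k => e' j k - e j k)%N); rewrite xpowD.
by apply: eq_xpow => j k; rewrite subnK.
Qed.

Lemma mcoeff_exp_gt (q : nat) (h : {mpoly K[q]}) i d (U : 'X_{1..q}) :
  (U i < d)%N -> (h * 'X_i ^+ d)@_U = 0.
Proof.
move=> lt_Ud; apply: memN_msupp_eq0; rewrite mpolyXn.
rewrite (perm_mem (msuppMX _ _)); apply/mapP => -[u _ eU].
move: lt_Ud; rewrite eU mnmDE mulmnE mnm1E eqxx mul1n.
by rewrite ltnNge leq_addr.
Qed.

(** The exponent vector of [xpow e]; needed to read off the coefficient of S. *)
Definition xexp e : 'X_{1..#|var g m|} :=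
  [multinom if enum_val i is inl (j, k) then e j k else 0%N | i < #|var g m|].

Lemma xpowE e : xpow e = 'X_[xexp e].
Proof.
rewrite mpolyXE_id (reindex (enum_rank : var g m -> _)) /=; last first.
  by apply: onW_bij; exists enum_val; [apply: enum_rankK|apply: enum_valK].
rewrite big_sumType /= [X in _ * X]big1 ?mulr1; last first.
  by move=> B _; rewrite mnmE enum_rankK expr0.
rewrite /xpow pair_big; apply: eq_bigr => -[j k] _.
by rewrite mnmE enum_rankK.
Qed.

End Monomials.

(** * The terms of f *)

Section Terms.
Context (K : fieldType) (g n : nat) (m : 'I_n -> nat).
Implicit Types (A : expmx g n m) (j : 'I_g) (k l c : 'I_n).

(** One index type for both sums of f, so that a single argument compares any
    two terms: [inl (k, l, A, j)] stands for X^A x_(j,k)^(m_k) x_(j,l)^(d_l),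
    with l = k + 1 and A in calA k imposed by [is_term], and [inr B] stands for
    X^B y_B.  Columns are counted from 0 here. *)
Definition term : finType :=
  ('I_n * 'I_n * expmx g n m * 'I_g + {B : expmx g n m | B \in calA g m n})%type.
Implicit Types t u : term.

Definition is_term t :=
  if t is inl (k, l, A, _) then (l == k.+1 :> nat) && (A \in calA g m k)
  else true.

Definition term_coef t : polyR K g m := if t is inr B then yvar K B else 1.

Definition term_exp t j c : nat :=
  match t with
  | inl (k, l, A, j0) =>
      A j c + ((j == j0) && (c == k)) * m k + ((j == j0) && (c == l)) * dd m l
  | inr B => val B j c
  end.

(** The columns of the term whose entries are at most M: those that come from
    the matrix A or B. *)
Definition bounded_cols t : nat := if t is inl (k, _, _, _) then k else n.

(** The columns whose entries sum to m; compared with [bounded_cols] this also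
    includes the column carrying x_(j,k)^(m_k). *)
Definition fixed_cols t : nat := if t is inl (k, _, _, _) then k.+1 else n.

Lemma fpolyE :
  fpoly K g m = \sum_(t | is_term t) xpow K m (term_exp t) * term_coef t.
Proof.
have xmE A : xmonom K A = xpow K m (fun j c => A j c) by [].
rewrite big_sumType /=; congr (_ + _).
do 3!rewrite pair_big_dep /=.
apply: eq_big => [[[[k l] A] j]|[[[k l] A] j] _] /=; first by rewrite andbT.
by rewrite mulr1 xmE !xpow_delta !xpowD.
Qed.

Lemma calA_bound r A j c :
  A \in calA g m r -> (c < r)%N -> (A j c <= Mbound m c)%N.
Proof. by rewrite inE => /forallP/(_ c) + cr; rewrite cr => /andP[/forallP->]. Qed.

Lemma calA_sum r A c :
  A \in calA g m r -> (c < r)%N -> (\sum_j A j c)%N = m c.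
Proof. by rewrite inE => /forallP/(_ c) + cr; rewrite cr => /andP[_ /eqP]. Qed.

Lemma calA_zero r A j c : A \in calA g m r -> (r <= c)%N -> A j c = 0%N :> nat.
Proof.
by rewrite inE leqNgt => /forallP/(_ c) + /negPf rc; rewrite rc => /forallP/(_ j)/eqP.
Qed.

Lemma term_exp_bounded_col k l A j0 j c :
    is_term (inl (k, l, A, j0)) -> (c < k)%N ->
  term_exp (inl (k, l, A, j0)) j c = A j c.
Proof.
case/andP=> /eqP lk _ ck /=.
have [/negPf-> /negPf->] : c != k /\ c != l.
  by rewrite -!val_eqE /= lk !ltn_eqF // ltnW.
by rewrite !andbF !addn0.
Qed.

Lemma term_exp_pure k l A j0 j : is_term (inl (k, l, A, j0)) ->
  term_exp (inl (k, l, A, j0)) j k = ((j == j0) * m k)%N.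
Proof.
case/andP=> /eqP lk Ak /=; rewrite (calA_zero _ Ak) // eqxx andbT.
by rewrite -[k == l]val_eqE /= lk ltn_eqF // andbF !addn0.
Qed.

Lemma term_exp_bound t j c :
  is_term t -> (c < bounded_cols t)%N -> (term_exp t j c <= Mbound m c)%N.
Proof.
case: t => [[[[k l] A] j0]|B] vt cf; last exact: calA_bound (valP B) cf.
by rewrite term_exp_bounded_col //; apply: calA_bound cf; case/andP: vt.
Qed.

Lemma term_exp_sum t c :
  is_term t -> (c < fixed_cols t)%N -> (\sum_j term_exp t j c)%N = m c.
Proof.
case: t => [[[[k l] A] j0]|B] vt cr; last exact: calA_sum (valP B) cr.
move: cr; rewrite /= ltnS leq_eqVlt => /predU1P[/val_inj ->|ck].
  rewrite (eq_bigr _ (fun j _ => term_exp_pure j vt)) (bigD1 j0) //= eqxx mul1n.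
  by rewrite big1 ?addn0 // => j /negPf->.
rewrite (eq_bigr _ (fun j _ => term_exp_bounded_col j vt ck)); apply: calA_sum ck.
by case/andP: vt.
Qed.

Lemma term_exp_le t j c :
  is_term t -> (c < fixed_cols t)%N -> (term_exp t j c <= m c)%N.
Proof. by move=> vt cr; rewrite -(term_exp_sum vt cr) (bigD1 j) //= leq_addr. Qed.

Section Distinct.
Hypotheses (hm1 : forall k : 'I_n, k.+2 = n -> (1 <= m k)%N)
           (hm2 : forall k : 'I_n, (k.+2 < n)%N -> (2 <= m k)%N).

Lemma m_gt0 k : (k.+1 < n)%N -> (0 < m k)%N.
Proof. by rewrite leq_eqVlt => /predU1P[/hm1|/hm2/ltnW]. Qed.

(** The pure power x_(j0,k)^(m_k) breaks the bound M_k = m_k - 1, so it cannot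
    occur in a term [u] whose column k comes from a matrix. *)
Lemma term_exp_pure_neq k l A j0 u :
    is_term (inl (k, l, A, j0)) -> is_term u -> (k < bounded_cols u)%N ->
  term_exp (inl (k, l, A, j0)) j0 k != term_exp u j0 k.
Proof.
move=> vt vu ku; rewrite term_exp_pure // eqxx mul1n.
have kn : (k.+1 < n)%N by case/andP: vt => /eqP <-.
have := term_exp_bound j0 vu ku; rewrite /Mbound (ltn_eqF kn) => le_u.
by rewrite gtn_eqF //; apply: leq_ltn_trans le_u _; rewrite ltn_predL m_gt0.
Qed.

(** Terms with different indices k are told apart by the pure power x_(j,k)^(m_k)
    of the one with the smaller index.  For equal k, either the pure powers sit
    in different rows, or the two matrices differ in a column they control. *)
Lemma term_exp_distinct t u : is_term t -> is_term u -> t != u ->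
  exists2 c : 'I_n, (c < minn (fixed_cols t) (fixed_cols u))%N
    & exists j, term_exp t j c != term_exp u j c.
Proof.
have mx_neq A B : A != B -> exists (c : 'I_n) j, A j c != B j c :> nat.
  move=> neqAB; have /existsP[j /existsP[c h]] : [exists j, exists c, A j c != B j c].
    apply: contraR neqAB => /existsPn eqAB; apply/eqP/matrixP => j c.
    by apply/eqP; have /existsPn/(_ c) := eqAB j; rewrite negbK.
  by exists c, j.
case: t u => [[[[k l] A] j0]|B] [[[[k' l'] A'] j0']|B'] vt vu neq.
- have [kk'|k'k|/val_inj kk'] := ltngtP k k'.
  + exists k; first by rewrite leq_min /= ltnSn ltnS ltnW.
    by exists j0; apply: term_exp_pure_neq.
  + exists k'; first by rewrite leq_min /= ltnSn ltnS ltnW.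
    by exists j0'; rewrite eq_sym; apply: term_exp_pure_neq.
  rewrite -{k'}kk' in vu neq *.
  have ll' : l = l'.
    by case/andP: vt vu => /eqP lk _ /andP[/eqP l'k _]; apply: val_inj; rewrite /= lk l'k.
  rewrite -{l'}ll' in vu neq *.
  have kn : (k.+1 < n)%N by case/andP: vt => /eqP <-.
  have [jj|/negPf njj] := eqVneq j0 j0'; last first.
    exists k; first by rewrite minnn /=.
    by exists j0; rewrite !term_exp_pure // eqxx njj mul1n -lt0n m_gt0.
  rewrite -{j0'}jj in vu neq *.
  have [c [j Ajc]] : exists (c : 'I_n) j, A j c != A' j c :> nat.
    by apply: mx_neq; apply: contraNneq neq => ->.
  have ck : (c < k)%N.
    rewrite ltnNge; apply: contra Ajc => kc.
    by case/andP: vt vu => _ Ak /andP[_ A'k]; rewrite !(calA_zero _ _ kc).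
  exists c; first by rewrite minnn /= ltnS ltnW.
  by exists j; rewrite !term_exp_bounded_col.
- exists k; first by rewrite leq_min /= ltnSn /=.
  by exists j0; apply: term_exp_pure_neq.
- exists k'; first by rewrite leq_min /= ltnSn andbT.
  by exists j0'; rewrite eq_sym; apply: term_exp_pure_neq.
have [c [j Bjc]] : exists (c : 'I_n) j, val B j c != val B' j c :> nat.
  by apply: mx_neq; apply: contraNneq neq => /val_inj ->.
by exists c; [rewrite minnn /= | exists j].
Qed.

(** In the first column where the terms differ the two column sums agree, so
    neither column can dominate the other. *)
Lemma term_exp_overflow t u : is_term t -> is_term u -> t != u ->
  exists (c : 'I_n) j, [/\ (c < minn (fixed_cols t) (fixed_cols u))%N,
    forall j' (c' : 'I_n), (c' < c)%N -> term_exp t j' c' = term_exp u j' c'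
  & (term_exp t j c < term_exp u j c)%N].
Proof.
move=> vt vu neq; have [c0 c0r [j1 dj1]] := term_exp_distinct vt vu neq.
pose D c := [exists j, term_exp t j c != term_exp u j c].
have Dc0 : D c0 by apply/existsP; exists j1.
case: (arg_minnP val Dc0) => c /existsP[j2 dj2] cmin.
have cr : (c < minn (fixed_cols t) (fixed_cols u))%N.
  by apply: leq_ltn_trans c0r; apply: cmin.
have [ct cu] : (c < fixed_cols t)%N /\ (c < fixed_cols u)%N.
  by apply/andP; rewrite -leq_min.
have [j lt_tu] : exists j, (term_exp t j c < term_exp u j c)%N.
  apply/existsP; apply: contraNT dj2 => /existsPn le_ut.
  have leif_ut j : true ->
      (term_exp u j c <= term_exp t j c
         ?= iff (term_exp u j c == term_exp t j c))%N.
    by move=> _; apply/leqif_eq; rewrite leqNgt.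
  have := (leqif_sum leif_ut).2; rewrite !term_exp_sum // eqxx eq_sym.
  by move/esym/forallP/(_ j2).
exists c, j; split=> // j' c' c'c; apply/eqP; apply: contraLR c'c => d'.
by rewrite -leqNgt; apply: cmin; apply/existsP; exists j'.
Qed.

(** Splitting m_c as (m_c - 1) + 1 over two rows respects the bound M_c; two
    rows and m_c >= 2 are exactly what this needs. *)
Lemma calA_nonempty k :
  (1 < g)%N -> (k.+1 < n)%N -> exists A, A \in calA g m k.
Proof.
move=> g1 kn; pose j0 := Ordinal (ltnW g1); pose j1 := Ordinal g1.
pose a c j := if j == j0 then (m c).-1 else nat_of_bool (j == j1).
have m2 c : (c < k)%N -> (1 < m c)%N.
  by move=> ck; apply: hm2; apply: leq_ltn_trans kn.
have m_le c : (m c < dd m 0)%N by rewrite ltnS (bigD1 c) //= leq_addr.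
have a_lt c j : (c < k)%N -> (a c j < dd m 0)%N.
  move=> ck; apply: leq_trans (m_le c); have := m2 c ck; rewrite /a.
  by case: ifP => _; case: (m c) => [|[|q]] //; case: eqP.
exists (\matrix_(j, c) if (c < k)%N then inord (a c j) else ord0).
have aK c j : (c < k)%N -> (inord (a c j) : 'I_(dd m 0)) = a c j :> nat.
  by move=> ck; rewrite inordK ?a_lt.
rewrite inE; apply/forallP => c; case: ifPn => ck; last first.
  by apply/forallP => j; rewrite mxE (negPf ck).
apply/andP; split.
  apply/forallP => j; rewrite mxE ck aK // /Mbound.
  rewrite (ltn_eqF (leq_ltn_trans ck (ltnW kn))).
  have := m2 c ck; rewrite /a; case: ifP => // _.
  by case: (m c) => [|[|q]] // _; apply: leq_trans (leq_b1 _) _.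
rewrite (eq_bigr (a c)) => [|j _]; last by rewrite mxE ck aK.
rewrite (bigD1 j0) // (bigD1 j1) //= /a eqxx big1 => [|j /andP[/negPf-> /negPf->]] //.
by rewrite eqxx addn0 addn1 prednK // ltnW ?m2.
Qed.

End Distinct.
End Terms.

(** * The socle element *)

Section Socle.
Context (K : fieldType) (g n : nat) (m : 'I_n -> nat).
Context (hg : (2 <= g)%N)
  (hm1 : forall k : 'I_n, k.+2 = n -> (1 <= m k)%N)
  (hm2 : forall k : 'I_n, (k.+2 < n)%N -> (2 <= m k)%N).
Notation I := (@idealI K g n m).
Notation x := (xvar K m).
Notation X := (xpow K m).

(** Exponents of the product of x_(j,c)^(d_c - 1) over the columns c < r; for
    r = n this is the socle element. *)
Definition full (r : nat) (j : 'I_g) (c : 'I_n) : nat :=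
  if (c < r)%N then (dd m c).-1 else 0%N.

Definition cofactor (t : term g m) j c : nat :=
  (full (fixed_cols t) j c - term_exp t j c)%N.

(** With [term_exp_le], keeps the subtraction in [cofactor] from truncating on
    the fixed columns. *)
Lemma m_le_dd c : (m c <= (dd m c).-1)%N.
Proof. by rewrite /dd /= (bigD1 c) //= leq_addr. Qed.

Lemma corner_dvd (e : 'I_g -> 'I_n -> nat) (c : 'I_n) j :
    (forall j' (c' : 'I_n), (c' < c)%N -> e j' c' = (dd m c').-1) ->
    (dd m c <= e j c)%N ->
  exists h, X e = h * (X (full c) * x j c ^+ dd m c).
Proof.
move=> e_lt e_c; rewrite xpow_delta xpowD; apply: xpow_dvd => j' c'.
rewrite /full; have [c'c|cc'|/val_inj ->] := ltngtP c' c.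
- by rewrite -[c' == c]val_eqE /= ltn_eqF // andbF addn0 e_lt.
- by rewrite -[c' == c]val_eqE /= gtn_eqF // andbF.
by rewrite eqxx andbT add0n; case: (j' =P j) => [->|_]; rewrite ?mul1n ?mul0n.
Qed.

(** The cofactor completes [t] to the full exponents d_c - 1 on its fixed
    columns, so that any other term, overflowing [t] somewhere, is a multiple
    of a corner in one of these columns. *)
Lemma f_term_in (t : term g m) :
    is_term t ->
    (forall (c : 'I_n) j,
       (c < fixed_cols t)%N -> I (X (full c) * x j c ^+ dd m c)) ->
  I (X (cofactor t) * X (term_exp t) * term_coef K t).
Proof.
move=> vt It; set P := X _; rewrite -mulrA.
pose F u := P * (X (term_exp u) * term_coef K u).
apply: (@ideal_gen_summand _ _ _ (@is_term g n m) F) => // [|u vu ut].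
  rewrite -mulr_sumr -fpolyE; apply/ideal_genMl/ideal_gen_mem.
  by rewrite mem_rcons mem_head.
have [|c [j [+ eq_tu lt_tu]]] := term_exp_overflow hm1 hm2 vt vu; first by rewrite eq_sym.
rewrite leq_min => /andP[ct cu].
rewrite /F mulrA xpowD; apply: ideal_genMr.
have [j' c' c'c||h ->] := @corner_dvd
  (fun j c => cofactor t j c + term_exp u j c)%N c j.
- have c't := ltn_trans c'c ct.
  rewrite /cofactor /full c't -eq_tu // subnK //.
  by rewrite (leq_trans (term_exp_le _ vt c't)) ?m_le_dd.
- rewrite /cofactor /full ct; apply: leq_trans (leq_add (leqnn _) lt_tu).
  by rewrite addnS subnK // (leq_trans (term_exp_le _ vt ct)) ?m_le_dd.
by apply: ideal_genMl; apply: It.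
Qed.

(** By induction on the column: a corner in column k + 1 is the completion of a
    term of f whose fixed columns are those before k + 1. *)
Lemma corner_in (c : 'I_n) j : I (X (full c) * x j c ^+ dd m c).
Proof.
have [r] := ubnP (c : nat); elim: r => // r IHr in c j *; rewrite ltnS => cr.
have [c0|c_gt0] := posnP c.
  apply/ideal_genMl/ideal_gen_mem; rewrite mem_rcons inE; apply/orP; right.
  apply/allpairsP; exists (j, c); rewrite !mem_enum inE c0; split=> //.
  exact/eqP.
have kn : (c.-1 < n)%N by apply: leq_ltn_trans (leq_pred c) (ltn_ord c).
pose k := Ordinal kn; have ck : c = k.+1 :> nat by rewrite /= prednK.
have [|A Ak] := @calA_nonempty g n m hm2 k hg; first by rewrite -ck.
pose t : term g m := inl (k, c, A, j).
have vt : is_term t by rewrite /= Ak prednK //= eqxx.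
have fixed_t : fixed_cols t = c by rewrite ck.
suff -> : X (full c) * x j c ^+ dd m c
    = X (cofactor t) * X (term_exp t) * term_coef K t.
  apply: f_term_in => // c' j'; rewrite fixed_t => c'c; apply: IHr.
  exact: leq_trans c'c cr.
rewrite mulr1 xpow_delta !xpowD; apply: eq_xpow => j' c'; rewrite /cofactor /full fixed_t.
have [c'c|cc'] := ltnP c' c.
  rewrite subnK; last first.
    by rewrite (leq_trans (term_exp_le _ vt _)) ?m_le_dd ?fixed_t.
  by rewrite -[c' == c]val_eqE /= (ltn_eqF c'c) andbF addn0.
have kc' : (k < c')%N by rewrite -ck.
rewrite sub0n /= (calA_zero j' Ak (ltnW kc')).
by rewrite -[c' == k]val_eqE /= (gtn_eqF kc') andbF.
Qed.

Lemma full_complement e : (forall j c, e j c <= m c)%N ->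
  X (fun j c => full n j c - e j c)%N * X e = X (full n).
Proof.
move=> le_em; rewrite xpowD; apply: eq_xpow => j c.
by rewrite subnK // /full ltn_ord (leq_trans (le_em j c)) ?m_le_dd.
Qed.

Lemma socle_x j c : I (x j c * X (full n)).
Proof.
have -> : x j c = X (fun j' c' => (j' == j) && (c' == c)).
  by rewrite -[LHS]expr1 xpow_delta; apply: eq_xpow => j' c'; rewrite muln1.
rewrite xpowD.
have [j' c' c'c||h ->] := @corner_dvd
  (fun j' c' => ((j' == j) && (c' == c)) + full n j' c')%N c j.
- by rewrite /full ltn_ord -[c' == c]val_eqE /= ltn_eqF // andbF.
- by rewrite !eqxx /full ltn_ord.
by apply: ideal_genMl; apply: corner_in.
Qed.

Lemma socle_y B : I (yvar K B * X (full n)).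
Proof.
have vB : is_term (inr B : term g m) by [].
rewrite mulrC -(@full_complement (term_exp (inr B))) => [|j c]; last exact: term_exp_le.
by apply: (f_term_in vB) => c j _; apply: corner_in.
Qed.

Lemma socle p : @maxideal K g n m p -> I (p * X (full n)).
Proof.
move: p; apply: ideal_gen_ind => [|p q Ip Iq|h p /mapP[i _ ->]].
- by rewrite mul0r; apply: ideal_gen0.
- by rewrite mulrDl; apply: ideal_genD.
rewrite -mulrA; apply: ideal_genMl; rewrite -[i]enum_valK.
by case: (enum_val i) => [[j c]|B]; [apply: socle_x | apply: socle_y].
Qed.

(** Every generator of I is a combination of the powers x_(j,c)^(d_c) and the
    variables y_B, none of which divides the socle monomial. *)
Lemma socle_notin : ~ I (X (full n)).
Proof.
pose U := xexp m (full n).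
(* Vanishing of this coefficient on all multiples of [p] is what makes [N]
   stable under multiplication. *)
pose N (p : polyR K g m) := forall h, (h * p)@_U = 0.
have N0 : N 0 by move=> h; rewrite mulr0 mcoeff0.
have ND p q : N p -> N q -> N (p + q).
  by move=> Np Nq h; rewrite mulrDr mcoeffD Np Nq addr0.
have NM h p : N p -> N (h * p) by move=> Np h'; rewrite mulrA.
have Nx j c : N (x j c ^+ dd m c).
  by move=> h; apply: mcoeff_exp_gt; rewrite mnmE enum_rankK /full ltn_ord.
have Ny B : N (yvar K B).
  move=> h; rewrite -[yvar K B]expr1; apply: mcoeff_exp_gt.
  by rewrite mnmE enum_rankK.
have Nf : N (fpoly K g m).
  apply: (ND).
    by do 4!(apply: (big_ind N N0 ND) => ? _); apply: NM.
  by apply: (big_ind N N0 ND) => B _; apply: NM.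
suff IN p : I p -> N p.
  move/IN/(_ 1); rewrite mul1r xpowE mcoeffX eqxx => /eqP.
  by rewrite oner_eq0.
move: p; apply: ideal_gen_ind => // h p; rewrite mem_rcons inE => /predU1P[->|].
  exact: NM.
case/allpairsP => -[j c] [_ /= + ->]; rewrite mem_enum inE => c0.
by apply: (NM); have := Nx j c; rewrite (eqP c0).
Qed.

End Socle.

Theorem theorem3p2 (K : fieldType) (g n : nat) (m : 'I_n -> nat)
    (hg : (2 <= g)%N) (hn : (1 <= n)%N)
    (hm1 : forall k : 'I_n, k.+2 = n -> (1 <= m k)%N)
    (hm2 : forall k : 'I_n, (k.+2 < n)%N -> (2 <= m k)%N) :
  depth_quotient_is (@maxideal K g n m) (@idealI K g n m) 0.
Proof.
by apply: depth0_of_socle; [apply: socle_notin | apply: socle].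
Qed.
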